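(* Let $r\in\mathbb{R}$, let $S\subseteq\{1,2,\ldots,n-1\}$ and for each $i\in S$ let $k_i\in\mathbb{Z}$. Suppose $\mathcal{F}$ is an $r$-facet of maximal dimension in $$\bigcap_{i\in S}H_{\alpha_i+k_i-r}\subset\mathcal{A},$$ where $\alpha_i=e_i-e_{i+1}$. Then $\mathcal{F}$ is $r$-associate to any $r$-facet of maximal dimension in $$H_S=\begin{cases}\bigcap_{i\in S}H_{\alpha_i-r}&\text{if }n-1\notin S;\\ \bigcap_{i\in S,\,i\ne n-1}H_{\alpha_i-r}\cap H_{\alpha_{n-1}+K-r}&\text{if }n-1\in S,\end{cases}$$ where $K$ is defined as follows. Let $\lambda=(\lambda_1,\ldots,\lambda_{|\lambda|})$ be the unordered partition of $n$ determined by the maximally consecutive subsets of $S$: that is, $\lambda_1,\lambda_2,\ldots$ are the sizes, from left to right, of the maximal intervals of $\{1,\ldots,n\}$ obtained by declaring $i$ and $i+1$ to lie in the same interval exactly when $i\in S$; $|\lambda|$ is the number of parts. Let $x_l=1+\sum_{j<l}\lambda_j$ be the first element of the $l$-th interval. Then $K$ is any integer in the equivalence class modulo $\gcd(\lambda)$ (the greatest common divisor of the parts) of the sum $$-\sum_{l=1}^{|\lambda|}\sum_{j=1}^{\lambda_l-1}j\,k_{x_l+j-1}.$$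
   Context: Field and group. $k$ is a non-Archimedean local field with integer ring $\mathcal{R}$, maximal ideal $\mathcal{P}$, normalized valuation $\mathrm{val}$, and finite residue field of characteristic $p_{\mathfrak f}>3(n-1)$; $n\ge2$. $G=\mathrm{SL}_n(k)$, $\mathfrak{g}=\mathfrak{sl}_n(k)$, $\mathbb{T}$ is the diagonal torus, $\mathfrak{t}$ its Lie algebra over $k$. Filtrations. $\mathcal{B}(G)$ is the Bruhat-Tits building and $\mathcal{A}\subset\mathcal{B}(G)$ the apartment of $\mathbb{T}$, identified with $X_*(\mathbb{T})\otimes\mathbb{R}=\{x\in\mathbb{R}^n:\sum_i x_i=0\}$, with coordinate functions $e_i$. Roots: $\Phi=\{e_i-e_j:i\ne j\}$, with root space of $e_i-e_j$ the matrices supported at entry $(i,j)$. Affine roots: $\Psi=\{\phi+m:\phi\in\Phi,m\in\mathbb{Z}\}$, with $(\phi+m)(x)=\phi(x)+m$; $\mathfrak{g}_{\phi+m}$ is the set of elements of the root space $\mathfrak{g}_\phi$ with entries in $\mathcal{P}^m$. For $x\in\mathcal{A}$, $r\in\mathbb{R}$: $\mathfrak{t}_r=\{H\in\mathfrak{t}:\mathrm{val}(d\chi(H))\ge r\ \forall\chi\in X^*(\mathbb{T})\}$, $\mathfrak{g}_{x,r}=\mathfrak{t}_r\oplus\sum_{\psi(x)\ge r}\mathfrak{g}_\psi$, and $\mathfrak{g}_{x,r+}$ is defined with strict inequalities. These extend to $x\in\mathcal{B}(G)$ by $\mathfrak{g}_{gx,r}=\mathrm{Ad}(g)\mathfrak{g}_{x,r}$.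 Facets. For $\psi\in\Psi$, $H_{\psi-r}=\{x\in\mathcal{A}:\psi(x)=r\}$. For a finite subset $\Sigma\subseteq\Psi$, consider $\bigcap_{\psi\in\Sigma}H_{\psi-r}$ ($=\mathcal{A}$ if $\Sigma=\emptyset$). An $r$-facet of $\mathcal{A}$ is a connected component of $\bigcap_{\psi\in\Sigma}H_{\psi-r}\setminus\bigcup_{\psi\in\Psi\setminus\Sigma}H_{\psi-r}$ for some $\Sigma$. $A(\mathcal{F},\mathcal{A})$ is the smallest affine subspace of $\mathcal{A}$ containing $\mathcal{F}$, and $\dim\mathcal{F}=\dim A(\mathcal{F},\mathcal{A})$; the same definitions apply in any apartment. The generalized $r$-facet containing $x\in\mathcal{B}(G)$ is the set of $y\in\mathcal{B}(G)$ with $\mathfrak{g}_{x,r}=\mathfrak{g}_{y,r}$ and $\mathfrak{g}_{x,r+}=\mathfrak{g}_{y,r+}$; its nonempty intersections with apartments are $r$-facets. Two generalized $r$-facets $\mathcal{F}_1^{\mathcal B},\mathcal{F}_2^{\mathcal B}$ are $r$-associate if there exist $g\in G$ and an apartment $\mathcal{A}'$ with $A(\mathcal{F}_1^{\mathcal B}\cap\mathcal{A}',\mathcal{A}')=A(g\mathcal{F}_2^{\mathcal B}\cap\mathcal{A}',\mathcal{A}')\ne\emptyset$. Two $r$-facets of $\mathcal{A}$ are $r$-associate if the generalized $r$-facets containing them are. *)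

(* Defs.v *)
From HB Require Import structures.
From mathcomp Require Import all_boot all_order all_fingroup all_algebra.
From mathcomp Require Import generic_quotient ring lra.
From mathcomp Require Import all_classical all_reals all_analysis.

Set Implicit Arguments.
Unset Strict Implicit.
Unset Printing Implicit Defensive.

Import Order.TTheory GRing.Theory Num.Theory.
Import numFieldNormedType.Exports.

Local Open Scope classical_set_scope.
Local Open Scope ring_scope.

(* [inP v m x] is x \in P^m. The valuation v is only meaningful on nonzero
   elements; the value v 0 is never used. *)
Definition inP (K : fieldType) (v : K -> int) (m : int) (x : K) : bool :=
  (x == 0) || (m <= v x).

(* Complete discretely valued field with normalized valuation [nu] and finite
   residue field; equal characteristic is allowed. *)
Record localField := LocalField {
  lf_sort :> fieldType;
  nu : lf_sort -> int;
  nuM : forall x y, x != 0 -> y != 0 -> nu (x * y) = nu x + nu y;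
  nuD : forall x y, x != 0 -> y != 0 -> x + y != 0 ->
    Num.min (nu x) (nu y) <= nu (x + y);
  nu_unif : exists2 x, x != 0 & nu x = 1;
  nu_complete : forall u : nat -> lf_sort,
    (forall m : int, exists N, forall i j, (N <= i)%N -> (N <= j)%N ->
       inP nu m (u i - u j)) ->
    exists l, forall m : int, exists N, forall i, (N <= i)%N ->
       inP nu m (u i - l);
  nu_residue_finite : exists s : seq lf_sort, forall x, inP nu 0 x ->
    exists2 y, y \in s & inP nu 1 (x - y) }.

Definition residue_char (k : localField) (p : nat) : Prop :=
  prime p /\ inP (@nu k) 1 p%:R.

Section Valuation.
Variable k : localField.
Implicit Types x y : k.

Lemma nu1 : nu (1 : k) = 0.
Proof.
have := @nuM k 1 1 (oner_neq0 _) (oner_neq0 _).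
by rewrite mulr1 -[LHS]addr0 => /addrI.
Qed.

Lemma nuV x : x != 0 -> nu x^-1 = - nu x.
Proof.
move=> x0; apply/eqP; rewrite -addr_eq0 addrC -nuM ?invr_eq0//.
by rewrite divff// nu1.
Qed.

Lemma inPMl m x y : y != 0 -> inP (@nu k) m x -> inP (@nu k) (m + nu y) (x * y).
Proof.
rewrite /inP => y0 /orP[/eqP->|mx]; first by rewrite mul0r eqxx.
have [->|x0] := eqVneq x 0; first by rewrite mul0r eqxx.
by rewrite nuM// lerD2r mx orbT.
Qed.

Lemma nuN1 : nu (-1 : k) = 0.
Proof.
have n0 : (-1 : k) != 0 by rewrite oppr_eq0 oner_neq0.
have := nuM n0 n0; rewrite mulrNN mulr1 nu1 => /eqP.
by rewrite eq_sym -mulr2n mulrn_eq0 /= => /eqP.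
Qed.

Lemma inPN m x : inP (@nu k) m (- x) = inP (@nu k) m x.
Proof.
rewrite /inP oppr_eq0; have [//|x0 /=] := eqVneq x 0.
by rewrite -mulN1r nuM// ?oppr_eq0 ?oner_neq0// nuN1 add0r.
Qed.

End Valuation.

(* The valuation in \bar R, with val 0 = +oo. *)
Definition nue (R : realType) (k : localField) (x : k) : \bar R :=
  if x == 0 then +oo%E else ((nu x)%:~R)%:E.

Section Apartment.
Variables (R : realType) (n : nat).

Definition in_apt (x : 'rV[R]_n) : bool := \sum_i x 0 i == 0.
Definition apt := {x : 'rV[R]_n | in_apt x}.

(* (i, j, m) encodes e_i - e_j + m; it is an affine root when i != j. *)
Definition affroot := ('I_n * 'I_n * int)%type.
Definition is_affroot (psi : affroot) : bool := psi.1.1 != psi.1.2.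
Definition affeval (psi : affroot) (x : 'rV[R]_n) : R :=
  x 0 psi.1.1 - x 0 psi.1.2 + psi.2%:~R.

Definition hyp (r : R) (psi : affroot) : set 'rV[R]_n :=
  [set x | in_apt x /\ affeval psi x = r].

Definition facet_locus (r : R) (Sigma : set affroot) : set 'rV[R]_n :=
  [set x | in_apt x] `&` (\bigcap_(psi in Sigma) hyp r psi)
  `\` (\bigcup_(psi in [set psi | is_affroot psi] `\` Sigma) hyp r psi).

Definition is_facet (r : R) (F : set 'rV[R]_n) : Prop :=
  exists Sigma : set affroot,
    [/\ finite_set Sigma, Sigma `<=` [set psi | is_affroot psi] &
        exists2 x, facet_locus r Sigma x &
          F = connected_component (facet_locus r Sigma) x].

(* The empty set counts as affine, so that [aff set0] is empty. *)
Definition is_affine (U : set 'rV[R]_n) : Prop :=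
  forall x y t, U x -> U y -> U ((1 - t) *: x + t *: y).

Definition aff (F : set 'rV[R]_n) : set 'rV[R]_n :=
  \bigcap_(U in [set U : set 'rV[R]_n |
     [/\ is_affine U, U `<=` [set x | in_apt x] & F `<=` U]]) U.

Definition affdim (U : set 'rV[R]_n) : nat :=
  get [set d | exists (a : 'rV[R]_n) (V : {vspace 'rV[R]_n}),
    U = [set a + v | v in [set` V]] /\ \dim V = d].

Definition fdim (F : set 'rV[R]_n) : nat := affdim (aff F).

Definition max_facet_in (r : R) (H F : set 'rV[R]_n) : Prop :=
  [/\ is_facet r F, F `<=` H &
      forall F', is_facet r F' -> F' `<=` H -> (fdim F' <= fdim F)%N].

End Apartment.

Section Building.
Variables (R : realType) (k : localField) (n : nat).
Implicit Types (g h u w X Y : 'M[k]_n) (x y : 'rV[R]_n) (psi : affroot n).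

Definition root_sub psi : set 'M[k]_n :=
  [set Y | (forall a b, (a, b) != psi.1 -> Y a b = 0) /\
           inP (@nu k) psi.2 (Y psi.1.1 psi.1.2)].

Definition above (s : bool) (r : R) (a : \bar R) : bool :=
  (if s then r%:E < a else r%:E <= a)%E.

(* t_r for s = false and t_(r+) for s = true. The characters of the diagonal
   torus are the maps diag(t_i) |-> \prod_i t_i ^ (c i), with differential
   H |-> \sum_i (c i) H_ii. *)
Definition tor_lat (s : bool) (r : R) : set 'M[k]_n :=
  [set H | [/\ is_diag_mx H, \tr H = 0 & forall c : 'I_n -> int,
     above s r (nue R (\sum_i (c i)%:~R * H i i))]].

(* g_(x,r) for s = false and g_(x,r+) for s = true. *)
Definition mp_lat (s : bool) (r : R) (x : 'rV[R]_n) : set 'M[k]_n :=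
  [set X | exists H (Ys : seq 'M[k]_n),
     [/\ tor_lat s r H,
         forall Y, Y \in Ys -> exists psi,
           [/\ is_affroot psi, above s r (affeval psi x)%:E & root_sub psi Y] &
         X = H + \sum_(Y <- Ys) Y]].

(* The group U_x generated by the affine root subgroups 1 + g_psi with
   psi(x) >= 0; as (1 + Y)^-1 = 1 - Y, products of generators suffice. *)
Inductive Ugrp (x : 'rV[R]_n) : 'M[k]_n -> Prop :=
| Ugrp1 : Ugrp x 1%:M
| UgrpM psi Y u : is_affroot psi -> 0 <= affeval psi x -> root_sub psi Y ->
    Ugrp x u -> Ugrp x ((1%:M + Y) *m u).

(* The elements of the normalizer of the diagonal torus in SL_n. *)
Definition monomial w : Prop :=
  \det w = 1 /\ exists sigma : 'S_n, forall i j, (w i j != 0) = (i == sigma j).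

(* The affine action of monomial matrices on the apartment: if w sends the
   j-th basis vector to c times the i-th one, then (w x)_i = x_j - val(c). *)
Definition mon_act w x : 'rV[R]_n :=
  \row_i \sum_(j | w i j != 0) (x 0 j - (nu (w i j))%:~R).

Lemma det_unit g : \det g = 1 -> g \in unitmx.
Proof. by move=> d; rewrite unitmxE d unitr1. Qed.

Lemma monomial1 : monomial 1%:M.
Proof.
split; first exact: det1.
exists 1%g => i j; rewrite mxE perm1.
by case: (i == j); rewrite /= ?oner_neq0 ?eqxx.
Qed.

Lemma mon_actE w x (sigma : 'S_n) :
  (forall i j, (w i j != 0) = (i == sigma j)) ->
  forall j, mon_act w x 0 (sigma j) = x 0 j - (nu (w (sigma j) j))%:~R.
Proof.
move=> ws j; rewrite mxE (bigD1 j) /= ?ws// big1 ?addr0// => l.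
by rewrite ws => /andP[/eqP /perm_inj ->]; rewrite eqxx.
Qed.

Lemma mon_act1 x : mon_act 1%:M x = x.
Proof.
have H : forall i j, ((1%:M : 'M[k]_n) i j != 0) = (i == (1%g : 'S_n) j).
  by move=> i j; rewrite mxE perm1; case: (i == j); rewrite /= ?oner_neq0 ?eqxx.
apply/rowP => i; have := mon_actE x H i; rewrite perm1 => ->.
by rewrite mxE eqxx nu1 subr0.
Qed.

Lemma mulmx_mon w w' (sigma : 'S_n) :
  (forall i j, (w i j != 0) = (i == sigma j)) ->
  forall i j, (w' *m w) i j = w' i (sigma j) * w (sigma j) j.
Proof.
move=> ws i j; rewrite mxE (bigD1 (sigma j)) //= big1 ?addr0// => l.
by rewrite -ws negbK => /eqP ->; rewrite mulr0.
Qed.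

Lemma mulmon_mx w w' (sigma : 'S_n) :
  (forall i j, (w i j != 0) = (i == sigma j)) ->
  forall i j, (w *m w') (sigma i) j = w (sigma i) i * w' i j.
Proof.
move=> ws i j; rewrite mxE (bigD1 i) //= big1 ?addr0// => l li.
have : w (sigma i) l == 0.
  by rewrite -[_ == 0]negbK ws (inj_eq perm_inj) eq_sym.
by move/eqP ->; rewrite mul0r.
Qed.

Lemma monomialM w w' : monomial w -> monomial w' -> monomial (w' *m w).
Proof.
move=> [dw [s ws]] [dw' [s' ws']]; split; first by rewrite det_mulmx dw dw' mulr1.
exists (s * s')%g => i j; rewrite (mulmx_mon _ ws) mulf_eq0 negb_or ws' ws eqxx.
by rewrite andbT permM.
Qed.

Lemma mon_actM w w' x : monomial w -> monomial w' ->
  mon_act (w' *m w) x = mon_act w' (mon_act w x).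
Proof.
move=> mw mw'; have [_ [s ws]] := mw; have [_ [s' ws']] := mw'.
have [_ _] := monomialM mw mw'.
have wws : forall i j, ((w' *m w) i j != 0) = (i == (s * s')%g j).
  move=> i j; rewrite (mulmx_mon _ ws) mulf_eq0 negb_or ws' ws eqxx.
  by rewrite andbT permM.
apply/rowP => i; rewrite -[i](permKV (s * s')%g); set j := ((s * s')^-1%g i).
rewrite (mon_actE _ wws) permM (mon_actE _ ws') (mon_actE _ ws).
rewrite (mulmx_mon _ ws) nuM ?ws' ?ws//.
by rewrite rmorphD/= opprD addrA addrAC.
Qed.

Lemma monomialV w : monomial w -> monomial (invmx w).
Proof.
move=> [dw [s ws]]; have wu := det_unit dw.
split; first by rewrite det_inv dw invr1.
exists (s^-1)%g => i j.
have := mulmx_mon (invmx w) ws i (s^-1%g j).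
rewrite mulVmx// permKV mxE => e.
have w0 : w j (s^-1%g j) != 0 by rewrite ws permKV.
have -> : (invmx w i j != 0) = (invmx w i j * w j (s^-1%g j) != 0).
  by rewrite mulf_eq0 (negbTE w0) orbF.
by rewrite -e; case: (i == _) => /=; rewrite ?oner_neq0 ?eqxx.
Qed.

Lemma mon_actK w x : monomial w -> mon_act (invmx w) (mon_act w x) = x.
Proof.
move=> mw; rewrite -mon_actM//; last exact: monomialV.
by rewrite mulVmx ?mon_act1//; apply: det_unit; case: mw.
Qed.

Lemma root_sub_sq psi Y : is_affroot psi -> root_sub psi Y -> Y *m Y = 0.
Proof.
case: psi => [[i j] m] /= ij [Y0 _]; apply/matrixP => a b; rewrite !mxE.
apply: big1 => c _; have [e|] := eqVneq (a, c) (i, j); last first.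
  by move/Y0 ->; rewrite mul0r.
case: e => _ ->; rewrite (Y0 j b) ?mulr0//.
by apply: contra ij => /eqP[-> _]; rewrite /is_affroot.
Qed.

Lemma root_subN psi Y : root_sub psi Y -> root_sub psi (- Y).
Proof.
move=> [Y0 Yp]; split=> [a b ab|]; first by rewrite mxE Y0// oppr0.
by rewrite mxE inPN.
Qed.

Lemma UgrpMM x u w : Ugrp x u -> Ugrp x w -> Ugrp x (u *m w).
Proof.
elim=> [|psi Y {}u a b c _ IH] xw; first by rewrite mul1mx.
by rewrite -mulmxA; apply: UgrpM a b c _; exact: IH.
Qed.

Lemma root_sub_inv psi Y : is_affroot psi -> root_sub psi Y ->
  (1%:M + Y) *m (1%:M - Y) = 1%:M.
Proof.
move=> p rY; rewrite mulmxDl !mulmxBr (root_sub_sq p rY) !mul1mx mulmx1.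
by rewrite subr0 subrK.
Qed.

Lemma Ugrp_inv x u : Ugrp x u -> u \in unitmx /\ Ugrp x (invmx u).
Proof.
elim=> [|psi Y {}u a b c _ [uu IH]].
  by rewrite unitmx1 invmx1; split=> //; exact: Ugrp1.
have e := root_sub_inv a c; have [yu _] := mulmx1_unit e.
split; first by rewrite unitmx_mul yu.
have -> : invmx ((1%:M + Y) *m u) = invmx u *m ((1%:M - Y) *m 1%:M).
  apply: (can_inj (mulKmx (_ : (1%:M + Y) *m u \in unitmx))).
    by rewrite unitmx_mul yu.
  rewrite mulmxV; last by rewrite unitmx_mul yu.
  by rewrite mulmx1 mulmxA -[_ *m u *m _]mulmxA mulmxV// mulmx1.
apply: UgrpMM IH _; apply: UgrpM a b _ _; [exact: root_subN|exact: Ugrp1].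
Qed.

Definition root_act w (sigma : 'S_n) psi : affroot n :=
  (sigma psi.1.1, sigma psi.1.2,
   psi.2 + nu (w (sigma psi.1.1) psi.1.1) - nu (w (sigma psi.1.2) psi.1.2)).

Lemma root_conj w (sigma : 'S_n) psi Y :
  w \in unitmx -> (forall i j, (w i j != 0) = (i == sigma j)) ->
  root_sub psi Y -> root_sub (root_act w sigma psi) (w *m Y *m invmx w).
Proof.
case: psi => [[i j] m] wu ws [/= Y0 Ym].
have E a b : (w *m Y *m invmx w) (sigma a) (sigma b) =
    w (sigma a) a * Y a b / w (sigma b) b.
  have w0 : w (sigma b) b != 0 by rewrite ws.
  apply: (mulIf w0); rewrite divfK// -(mulmx_mon _ ws).
  by rewrite mulmxKV// (mulmon_mx _ ws).
split=> /= [a b|].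
  rewrite -[a](permKV sigma) -[b](permKV sigma) E => ab.
  rewrite Y0 ?mulr0 ?mul0r//.
  by apply: contra ab => /eqP[-> ->].
have wi : w (sigma i) i != 0 by rewrite ws.
have wj : w (sigma j) j != 0 by rewrite ws.
have wj' : (w (sigma j) j)^-1 != 0 by rewrite invr_eq0.
have := inPMl wj' (inPMl wi Ym).
by rewrite E nuV// [w _ i * _]mulrC.
Qed.

Lemma root_act_eval w (sigma : 'S_n) psi x :
  (forall i j, (w i j != 0) = (i == sigma j)) ->
  affeval (root_act w sigma psi) (mon_act w x) = affeval psi x.
Proof.
move=> ws; rewrite /affeval /= !(mon_actE _ ws) rmorphB rmorphD /=.
set a := x 0 _; set b := x 0 _; set c := (nu _)%:~R; set d := (nu _)%:~R.
by ring.
Qed.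

Lemma Ugrp_conj w x u : monomial w -> Ugrp x u ->
  Ugrp (mon_act w x) (w *m u *m invmx w).
Proof.
move=> [dw [s ws]]; have wu := det_unit dw.
elim=> [|psi Y {}u a b c _ IH]; first by rewrite mulmx1 mulmxV//; exact: Ugrp1.
have -> : w *m ((1%:M + Y) *m u) *m invmx w =
    (1%:M + w *m Y *m invmx w) *m (w *m u *m invmx w).
  rewrite mulmxDl mul1mx mulmxDl mul1mx mulmxDr mulmxDl; congr (_ + _).
  by rewrite !mulmxA mulmxKV.
apply: (@UgrpM _ (root_act w s psi)) IH.
- by rewrite /is_affroot /= (inj_eq perm_inj).
- by rewrite root_act_eval.
- exact: root_conj.
Qed.

Definition SL := {g : 'M[k]_n | \det g == 1}.

Lemma SLP (g : SL) : \det (val g) = 1. Proof. exact/eqP/(valP g). Qed.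

Fact SL1_subproof : \det (1%:M : 'M[k]_n) == 1.
Proof. by rewrite det1. Qed.
Definition SL1 : SL := Sub 1%:M SL1_subproof.

Fact SLM_subproof (g h : SL) : \det (val g *m val h) == 1.
Proof. by rewrite det_mulmx !SLP mulr1. Qed.
Definition SLM (g h : SL) : SL := Sub (val g *m val h) (SLM_subproof g h).

(* The Bruhat-Tits relation on G x A: (g, x) ~ (h, y) iff there is w in the
   normalizer of the torus with y = w x and g^-1 h w in U_x. *)
Definition bt_rel (p q : SL * apt R n) : bool :=
  `[< exists w, [/\ monomial w, mon_act w (val p.2) = val q.2 &
        Ugrp (val p.2) (invmx (val p.1) *m val q.1 *m w)] >].

Fact bt_refl : reflexive bt_rel.
Proof.
move=> [g x]; apply/asboolP; exists 1%:M; split=> /=.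
- exact: monomial1.
- exact: mon_act1.
- by rewrite mulVmx ?mulmx1; [exact: Ugrp1|exact/det_unit/SLP].
Qed.

Fact bt_sym1 p q : bt_rel p q -> bt_rel q p.
Proof.
case: p q => [g x] [h y] /asboolP[w /= [mw wx U]]; apply/asboolP.
have gu := det_unit (SLP g); have hu := det_unit (SLP h).
have wu : w \in unitmx by case: mw => /det_unit.
exists (invmx w); split=> /=; first exact: monomialV.
  by rewrite -wx mon_actK.
have [uu /(Ugrp_conj mw)] := Ugrp_inv U; rewrite wx.
suff -> : w *m invmx (invmx (val g) *m val h *m w) = invmx (val h) *m val g.
  by [].
apply: (can_inj (mulmxK uu)); rewrite mulmxKV// !mulmxA.
by rewrite mulmxK ?mulVmx// ?mul1mx.
Qed.

Fact bt_sym : symmetric bt_rel.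
Proof. by move=> p q; apply/idP/idP; exact: bt_sym1. Qed.

Fact bt_trans : transitive bt_rel.
Proof.
move=> [h y] [g x] [f z] /asboolP[w /= [mw wx U]] /asboolP[v /= [mv vy V]].
have gu := det_unit (SLP g); have hu := det_unit (SLP h).
have wu : w \in unitmx by case: mw => /det_unit.
apply/asboolP; exists (v *m w); split=> /=; first exact: monomialM.
  by rewrite mon_actM// wx.
have := UgrpMM U; have := Ugrp_conj (monomialV mw) V.
rewrite -wx mon_actK// => V' /(_ _ V').
have -> : invmx (invmx w) = w by exact: invmxK.
by rewrite !mulmxA mulmxK// mulmxK.
Qed.

Canonical bt_equiv := EquivRel bt_rel bt_refl bt_sym bt_trans.

(* The Bruhat-Tits building of SL_n(k). *)
Definition building := {eq_quot bt_equiv}%qT.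

(* [bpoint g x] is g.x; the reference apartment is embedded by [bpoint SL1],
   and the apartments are the images of the maps [bpoint g]. *)
Definition bpoint (g : SL) (x : apt R n) : building :=
  \pi_building%qT (g, x).

Definition bact (g : SL) (b : building) : building :=
  bpoint (SLM g (repr b).1) (repr b).2.

Lemma bpointP (g h : SL) (x y : apt R n) :
  bpoint g x = bpoint h y <-> bt_rel (g, x) (h, y).
Proof. by split=> [/eqmodP //|H]; exact/eqmodP. Qed.

Lemma bact_bpoint (g h : SL) (x : apt R n) : bact g (bpoint h x) = bpoint (SLM g h) x.
Proof.
rewrite /bact; set p := repr _.
have /bpointP/asboolP[w /= [mw wx U]] : bpoint p.1 p.2 = bpoint h x.
  by rewrite /bpoint -surjective_pairing reprK.
apply/bpointP/asboolP; exists w; split=> //=.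
have gu := det_unit (SLP g); have pu := det_unit (SLP p.1).
suff -> : invmx (val g *m val p.1) *m (val g *m val h) = invmx (val p.1) *m val h.
  by [].
have gpu : val g *m val p.1 \in unitmx by rewrite unitmx_mul gu.
apply: (can_inj (mulKmx gpu)); rewrite mulKVmx//.
by rewrite -!mulmxA mulKVmx.
Qed.

Definition Ad (g : SL) : 'M[k]_n -> 'M[k]_n :=
  fun X => val g *m X *m invmx (val g).

Definition mp_bld (s : bool) (r : R) (b : building) : set 'M[k]_n :=
  Ad (repr b).1 @` mp_lat s r (val (repr b).2).

Lemma nue0 : nue R (0 : k) = +oo%E.
Proof. by rewrite /nue eqxx. Qed.

Lemma above_nue (s : bool) (r : R) (a : k) :
  above s r (nue R a) =
  (a == 0) || (if s then r < (nu a)%:~R else r <= (nu a)%:~R).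
Proof.
rewrite /above /nue; case: eqVneq => /= _; first by case: s; rewrite ?ltry ?leey.
by rewrite lte_fin lee_fin.
Qed.

Lemma above_nue_le (s : bool) (r t : R) (a : k) :
  r <= t -> above s t (nue R a) -> above s r (nue R a).
Proof.
rewrite !above_nue => rt /orP[->//|H]; apply/orP; right.
by case: s H => H; [exact: le_lt_trans rt H|exact: le_trans rt H].
Qed.

Lemma above_nueD (s : bool) (r : R) (a b : k) :
  above s r (nue R a) -> above s r (nue R b) -> above s r (nue R (a + b)).
Proof.
rewrite !above_nue; have [->|a0 /= ra] := eqVneq a 0; first by rewrite add0r.
have [->|b0 /= rb] := eqVneq b 0; first by rewrite addr0 ra orbT.
have [//|ab0 /=] := eqVneq (a + b) 0.
have := nuD a0 b0 ab0; rewrite -(ler_int R).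
suff : if s then r < (Num.min (nu a) (nu b))%:~R
       else r <= (Num.min (nu a) (nu b))%:~R.
  by case: (s) => /= h1 h2; [exact: lt_le_trans h1 h2|exact: le_trans h1 h2].
by case: (leP (nu a) (nu b)).
Qed.

Lemma above_nue_sum (s : bool) (r : R) (I : Type) (l : seq I) (P : pred I)
    (F : I -> k) :
  (forall i, P i -> above s r (nue R (F i))) ->
  above s r (nue R (\sum_(i <- l | P i) F i)).
Proof.
move=> H; elim/big_ind: _ => //; first by rewrite above_nue eqxx.
by move=> a b; exact: above_nueD.
Qed.

Lemma above_nueN (s : bool) (r : R) (a : k) :
  above s r (nue R (- a)) = above s r (nue R a).
Proof.
rewrite !above_nue oppr_eq0; have [//|a0 /=] := eqVneq a 0.
by rewrite -mulN1r nuM ?oppr_eq0 ?oner_neq0// nuN1 add0r.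
Qed.

Lemma above_nueM (s : bool) (r t : R) (a b : k) :
  above false r (nue R a) -> above s t (nue R b) ->
  above s (r + t) (nue R (a * b)).
Proof.
rewrite !above_nue mulf_eq0; have [//|a0 /=] := eqVneq a 0.
have [//|b0 /=] := eqVneq b 0; rewrite nuM// rmorphD/= => ra.
by case: s => tb; [exact: ler_ltD|exact: lerD].
Qed.

Lemma above_nue_int (s : bool) (r : R) (c : int) (a : k) :
  above s r (nue R a) -> above s r (nue R (c%:~R * a)).
Proof.
move=> ra; have P m : above s r (nue R (a *+ m)).
  elim: m => [|m IH]; first by rewrite mulr0n above_nue eqxx.
  by rewrite mulrS above_nueD.
rewrite mulrzl; case: c => m; first by rewrite -pmulrn.
by rewrite NegzE mulrNz above_nueN -pmulrn.
Qed.

Lemma mp_latP (s : bool) (r : R) x X :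
  mp_lat s r x X <->
  \tr X = 0 /\ forall i j, above s (r - (x 0 i - x 0 j)) (nue R (X i j)).
Proof.
split=> [[H [Ys [[dH tH cH] hY ->]]]|[tX eX]].
  split.
    rewrite raddfD /= raddf_sum/= tH add0r big_seq big1// => Y /hY[psi [p _ [Y0 _]]].
    apply: big1 => i _; apply: Y0; apply: contra p => /eqP <- /=.
    by rewrite /is_affroot.
  move=> i j; rewrite mxE; apply: above_nueD.
    have [->|ij] := eqVneq i j; last first.
      by move/is_diag_mxP: dH => -> //; rewrite above_nue eqxx.
    rewrite subrr subr0; have := cH (fun l => (l == j)%:Z).
    rewrite (bigD1 j)//= eqxx mul1r big1 ?addr0// => l /negbTE ->.
    by rewrite mul0r.
  rewrite summxE big_seq; apply: above_nue_sum => Y /hY[psi [_ ap [Y0 Yp]]].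
  have [e|ne] := eqVneq (i, j) psi.1; last by rewrite Y0// above_nue eqxx.
  move: Yp ap; rewrite /affeval -e /= above_nue /inP /above.
  case/orP => [->//|m]; rewrite lte_fin lee_fin -(ler_int R) in m *.
  move=> H0; apply/orP; right; move: H0.
  by case: s {hY cH} => ?; rewrite ?ltrBlDl ?lerBlDl;
    [apply: lt_le_trans; first eassumption|apply: le_trans; first eassumption];
    rewrite lerD2l.
pose D := \matrix_(i, j) (if i == j then X i j else 0) : 'M[k]_n.
pose E (p : 'I_n * 'I_n) := X p.1 p.2 *: delta_mx p.1 p.2 : 'M[k]_n.
pose L := [seq p <- enum {: 'I_n * 'I_n} | (p.1 != p.2) && (X p.1 p.2 != 0)].
exists D, [seq E p | p <- L]; split.
- split.
  + by apply/is_diag_mxP => i j ij; rewrite mxE; have [e|//] := eqVneq i j;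
    rewrite e eqxx in ij.
  + by rewrite -tX; apply: eq_bigr => i _; rewrite mxE eqxx.
  + move=> c; apply: above_nue_sum => i _; apply: above_nue_int.
    by rewrite mxE eqxx; have := eX i i; rewrite subrr subr0.
- move=> Y /mapP[[i j]]; rewrite mem_filter /= => /andP[/andP[ij X0] _] ->.
  exists (i, j, nu (X i j)); split=> //=.
    have := eX i j; rewrite above_nue (negbTE X0) /= /above /affeval lte_fin lee_fin /=.
    by case: (s); rewrite ?ltrBlDl ?lerBlDl.
  split=> [a b ab|] /=; rewrite /E !mxE /=.
    by move: ab; rewrite /= xpair_eqE => /negbTE ->; rewrite mulr0.
  by rewrite !eqxx mulr1 /inP lexx orbT.
- rewrite big_map big_filter /= big_enum_cond /=.
  apply/matrixP => a b; rewrite !mxE summxE.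
  have [<-|ab] := eqVneq a b.
    rewrite big1 ?addr0// => -[i j] /andP[/= ij _].
    rewrite /E !mxE /=; case: (a =P i) => [->|]; rewrite ?mulr0//=.
    by rewrite (negbTE ij) mulr0.
  rewrite add0r; have [X0|X0] := eqVneq (X a b) 0.
    rewrite big1 // => -[i j] _; rewrite /E !mxE /=.
    by case: (a =P i) => [<-|] /=; rewrite ?mulr0//; case: (b =P j) => [<-|]; rewrite ?X0 ?mul0r ?mulr0.
  rewrite (bigD1 (a, b)) /= ?ab// big1 ?addr0; first by rewrite /E !mxE !eqxx mulr1.
  move=> [i j] /andP[_]; rewrite xpair_eqE /E !mxE /= ![_ == a]eq_sym ![_ == b]eq_sym.
  by move=> /negbTE ->; rewrite mulr0.
Qed.

Lemma Ugrp_entry x u : Ugrp x u ->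
  forall i j, above false (- (x 0 i - x 0 j)) (nue R (u i j)).
Proof.
have one i j : above false (- (x 0 i - x 0 j)) (nue R ((1%:M : 'M[k]_n) i j)).
  rewrite mxE above_nue; have [->|_] := eqVneq i j; last by rewrite eqxx.
  by rewrite subrr oppr0 nu1 lexx orbT.
elim=> [//|psi Y {}u p0 px [Y0 Ym] _ IH] i j; rewrite mxE.
apply: above_nue_sum => l _.
have -> : - (x 0 i - x 0 j) = - (x 0 i - x 0 l) - (x 0 l - x 0 j) by ring.
apply: above_nueM => //; rewrite mxE; apply: above_nueD => //.
have [e|ne] := eqVneq (i, l) psi.1; last by rewrite Y0// above_nue eqxx.
move: Ym px; rewrite above_nue /affeval /inP -e /=.
case/orP => [->//|m]; rewrite -(ler_int R) in m => H0; apply/orP; right.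
by rewrite (le_trans _ m)// -subr_ge0 opprK addrC.
Qed.

Lemma mp_lat_U s r x u X : Ugrp x u -> mp_lat s r x X ->
  mp_lat s r x (u *m X *m invmx u).
Proof.
move=> U /mp_latP[tX eX]; have [uu V] := Ugrp_inv U; apply/mp_latP; split.
  by rewrite mxtrace_mulC mulmxA mulVmx// mul1mx.
move=> i j; rewrite mxE; apply: above_nue_sum => l _; rewrite mulrC mxE.
rewrite mulr_sumr; apply: above_nue_sum => m _.
have -> : r - (x 0 i - x 0 j) =
  - (x 0 l - x 0 j) + (- (x 0 i - x 0 m) + (r - (x 0 m - x 0 l))) by ring.
by apply: above_nueM; [exact: Ugrp_entry|apply: above_nueM; [exact: Ugrp_entry|]].
Qed.

Lemma mp_lat_mon s r x w X : monomial w -> mp_lat s r x X ->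
  mp_lat s r (mon_act w x) (w *m X *m invmx w).
Proof.
move=> [dw [sg ws]] /mp_latP[tX eX]; have wu := det_unit dw.
apply/mp_latP; split; first by rewrite mxtrace_mulC mulmxA mulVmx// mul1mx.
move=> i j; rewrite -[i](permKV sg) -[j](permKV sg).
move: (sg^-1%g i) (sg^-1%g j) => a b; rewrite !(mon_actE _ ws).
have wa : w (sg a) a != 0 by rewrite ws.
have wb : w (sg b) b != 0 by rewrite ws.
have -> : (w *m X *m invmx w) (sg a) (sg b) =
    (w (sg b) b)^-1 * (w (sg a) a * X a b).
  rewrite mulrC; apply: (mulIf wb); rewrite divfK// -(mulmx_mon _ ws).
  by rewrite mulmxKV// (mulmon_mx _ ws).
set na := (nu (w (sg a) a))%:~R; set nb := (nu (w (sg b) b))%:~R.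
have -> : r - (x 0 a - na - (x 0 b - nb)) = - nb + (na + (r - (x 0 a - x 0 b)))
  by ring.
apply: above_nueM; last apply: above_nueM => //.
  by rewrite above_nue nuV// rmorphN lexx orbT.
by rewrite above_nue lexx orbT.
Qed.

(* g_(gx, r) = Ad(g) g_(x, r): [mp_bld] does not depend on representatives. *)
Lemma mp_bld_bpoint s r (g : SL) (x : apt R n) :
  mp_bld s r (bpoint g x) = Ad g @` mp_lat s r (val x).
Proof.
have sub (g' h : SL) (x' y : apt R n) : bt_rel (g', x') (h, y) ->
    Ad g' @` mp_lat s r (val x') `<=` Ad h @` mp_lat s r (val y).
  case/asboolP => w /= [mw wx U] _ [X HX <-].
  have gu := det_unit (SLP g'); have hu := det_unit (SLP h).
  have wu : w \in unitmx by case: mw => /det_unit.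
  have [uu V] := Ugrp_inv U; set u := _ *m w in U uu V.
  have uKu : invmx (invmx u) = u by exact: invmxK.
  exists (w *m (invmx u *m X *m u) *m invmx w).
    by rewrite -wx; apply: mp_lat_mon mw _; rewrite -{2}uKu; apply: mp_lat_U.
  have hg : val h = val g' *m u *m invmx w.
    by rewrite /u !mulmxA mulmxV// mul1mx mulmxK.
  clearbody u.
  have hw : val h *m w = val g' *m u by rewrite hg mulmxKV.
  have hwu : val h *m w *m invmx u = val g' by rewrite hw mulmxK.
  have wh : u *m invmx w *m invmx (val h) = invmx (val g').
    apply: (can_inj (mulKmx gu)); rewrite (mulmxV gu).
    by rewrite [LHS]mulmxA [X in X *m _]mulmxA -hg mulmxV.
  by rewrite /Ad !mulmxA hwu -!mulmxA; move: wh; rewrite -mulmxA => ->.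
rewrite /mp_bld; set p := repr _.
have e : bpoint p.1 p.2 = bpoint g x.
  by rewrite /bpoint -surjective_pairing reprK.
by apply/seteqP; split; apply: sub; apply/bpointP.
Qed.

Definition gfacet (r : R) (b : building) : set building :=
  [set b' | mp_bld false r b = mp_bld false r b' /\
            mp_bld true r b = mp_bld true r b'].

(* A(Y \cap A', A') for the apartment A' = h.A, whose affine structure is
   carried over from A by h. *)
Definition baff (h : SL) (Y : set building) : set building :=
  bpoint h @` (val @^-1` aff (val @` (bpoint h @^-1` Y))).

Definition gfacet_associate (E1 E2 : set building) : Prop :=
  exists g h : SL, baff h E1 = baff h (bact g @` E2) /\ baff h E1 !=set0.

Definition facet_associate (r : R) (F1 F2 : set 'rV[R]_n) : Prop :=
  exists b1 b2 : building,
    [/\ bpoint SL1 @` (val @^-1` F1) `<=` gfacet r b1,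
        bpoint SL1 @` (val @^-1` F2) `<=` gfacet r b2 &
        gfacet_associate (gfacet r b1) (gfacet r b2)].

End Building.

Section Standard.
Variables (R : realType) (n : nat).

(* Simple roots and coordinates are numbered from 0: [i : 'I_n.-1] stands for
   alpha_(i+1) = e_(i+1) - e_(i+2). *)
Fact simple_lo_subproof (i : 'I_n.-1) : (i < n)%N.
Proof. by rewrite (leq_trans (ltn_ord i))// leq_pred. Qed.
Fact simple_hi_subproof (i : 'I_n.-1) : (i.+1 < n)%N.
Proof. by rewrite -ltn_predRL. Qed.

(* alpha_i + m *)
Definition simple (i : 'I_n.-1) (m : int) : affroot n :=
  (Ordinal (simple_lo_subproof i), Ordinal (simple_hi_subproof i), m).

Definition simple_flat (r : R) (S : {set 'I_n.-1}) (c : 'I_n.-1 -> int) :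
    set 'rV[R]_n :=
  [set x | in_apt x] `&` \bigcap_(i in [set` S]) hyp r (simple i (c i)).

Definition is_last (i : 'I_n.-1) : bool := i.+2 == n.

Definition H_S (r : R) (S : {set 'I_n.-1}) (K : int) : set 'rV[R]_n :=
  simple_flat r S (fun i => if is_last i then K else 0).

(* The sizes, from left to right, of the maximal intervals: an interval ends
   just before position i.+1 when i \notin S, and the last one ends at n. *)
Definition intervals (S : {set 'I_n.-1}) : seq nat :=
  pairmap (fun a b => (b - a)%N) 0%N
    (rcons [seq (nat_of_ord i).+1 | i <- enum (~: S)] n).

Definition parts_gcd (S : {set 'I_n.-1}) : nat :=
  \big[gcdn/0%N]_(a <- intervals S) a.

(* - \sum_l \sum_(1 <= j < lambda_l) j * k_(x_l + j - 1), where the 0-based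
   first element of the l-th interval is the sum of the previous parts. *)
Definition K_sum (S : {set 'I_n.-1}) (c : nat -> int) : int :=
  - \sum_(0 <= l < size (intervals S))
      \sum_(1 <= j < nth 0%N (intervals S) l)
        j%:Z * c (\sum_(0 <= m < l) nth 0%N (intervals S) m + j - 1)%N.

End Standard.

(* Main.v *)
Require Import Defs.
From HB Require Import structures.
From mathcomp Require Import all_boot all_order all_fingroup all_algebra.
From mathcomp Require Import generic_quotient ring lra zify.
From mathcomp Require Import all_classical all_reals all_analysis.

Set Implicit Arguments.
Unset Strict Implicit.
Unset Printing Implicit Defensive.

Import Order.TTheory GRing.Theory Num.Theory.
Import numFieldNormedType.Exports.

Local Open Scope classical_set_scope.
Local Open Scope ring_scope.

(** Two facets of the standard apartment are associate as soon as an element of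
    the normalizer of the torus carries the affine span of one onto the affine
    span of the other, and here a diagonal matrix suffices.

    Geometry.  The [r]-facet through [x] is the [cell] of the points at which
    every affine root lies on the same side of [r] as at [x]
    ([component_cell]).  Affine roots are locally finite ([small_move_sgr]), so
    this cell is open in the intersection [flat] of the walls through [x], and
    its affine span is that flat ([aff_cell]).  A set cut out by simple affine
    roots contains a point lying on no walls but those containing the whole set
    ([simple_flat_generic]); comparing dimensions, a facet of maximal dimension
    in it has the whole set as affine span ([flat_max_facet]).

    Building.  Membership of the matrices [a *: delta_mx i j] in the lattices
    g_(x,r) and g_(x,r+) recovers the sign of every affine root minus [r], so
    the generalized facet of [x] meets the standard apartment exactly in the
    cell of [x] ([gfacet_preimage]).  Since the group permutes the generalized
    facets ([gfacet_bact]), a monomial matrix moving [y] to a point with the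
    same flat as [x] makes the facets of [x] and [y] associate
    ([facet_associate_monomial]).

    Arithmetic.  The diagonal matrix with entries of valuations t_i and
    determinant 1 translates the apartment by - t; the t_i sum to 0, and [H_S]
    is carried onto the given flat when t_i - t_(i+1) has a prescribed value for
    every i in S.  Modulo the gcd of the ends of the intervals, which divides
    every part, one solution of these difference equations has sum K - K_sum
    ([K_sum_mod], [last_sum_mod]); it may be modified by any sequence constant
    on the intervals, and the sums of such sequences include all multiples of
    this gcd ([attainable_dvd]).  The congruence on K is what lets the sum be
    corrected to 0 ([translation_vector]). *)

(** * Signs of real numbers *)

Section RealLemmas.
Variable R : realType.

(** Local finiteness of the affine roots with a given gradient: their values at
    a point form a coset of the integers, which is discrete. *)
Lemma int_translates_gap (a : R) :
  exists2 e : R, 0 < e & forall m : int, a + m%:~R != 0 -> e <= `|a + m%:~R|.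
Proof.
pose f := a - (Num.floor a)%:~R.
have /andP[fl0 fl1] := floor_itv a; rewrite intrD in fl1.
have f0 : 0 <= f by rewrite /f; lra.
have f1 : f < 1 by rewrite /f; lra.
have E m : a + m%:~R = f + (Num.floor a + m)%:~R by rewrite /f intrD; ring.
clearbody f.
(* The nonzero values closest to 0 on either side are f and f - 1, or 1 and -1
   when f vanishes. *)
exists (if f == 0 then 1 else Num.min f (1 - f)) => [|m].
  case: eqP => // /eqP f_neq0; rewrite lt_min subr_gt0 f1 andbT.
  by rewrite lt_def f_neq0.
rewrite E; move: (Num.floor a + m) => q h.
have [q0|q0] := ltP q 0.
  have : q <= -1 by lia.
  rewrite -(ler_int R) => qR; rewrite ltr0_norm; last by lra.
  case: eqP => [->|_]; first by lra.
  by rewrite ge_min; apply/orP; right; lra.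
have q0R := q0; rewrite -(ler_int R) in q0R; rewrite ger0_norm; last by lra.
case: (f =P 0) h => [->|_ _]; last by rewrite ge_min; apply/orP; left; lra.
by rewrite add0r intr_eq0 => h; rewrite -[1]/(1%:~R) ler_int; lia.
Qed.

Lemma sgr_addl_small (a b : R) : `|b| < `|a| -> Num.sg (a + b) = Num.sg a.
Proof.
have [a0|a0|->] := ltgtP a 0; last by rewrite normr0 normr_lt0.
- rewrite (ltr0_norm a0) ltr_norml => /andP[h1 h2].
  by rewrite !ltr0_sg//; lra.
- rewrite (gtr0_norm a0) ltr_norml => /andP[h1 h2].
  by rewrite !gtr0_sg//; lra.
Qed.

Lemma sgr_convex (a b t : R) : 0 <= t <= 1 -> Num.sg b = Num.sg a ->
  Num.sg ((1 - t) * a + t * b) = Num.sg a.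
Proof.
case/andP=> t0 t1; have [a0|a0|->] := ltgtP a 0.
- rewrite (ltr0_sg a0) => /eqP; rewrite sgr_cp0 => b0.
  by apply/eqP; rewrite sgr_cp0; nra.
- rewrite (gtr0_sg a0) => /eqP; rewrite sgr_cp0 => b0.
  by apply/eqP; rewrite sgr_cp0; nra.
- by rewrite sgr0 => /eqP; rewrite sgr_cp0 => /eqP ->;
  rewrite !mulr0 addr0 sgr0.
Qed.

End RealLemmas.

(** * Facets and the flats they span *)

Section Cells.
Variables (R : realType) (n : nat) (r : R).
Implicit Types (x y z v : 'rV[R]_n) (psi : affroot n).

Definition cell x : set 'rV[R]_n :=
  [set z | in_apt z /\ forall psi, is_affroot psi ->
     Num.sg (affeval psi z - r) = Num.sg (affeval psi x - r)].

Definition flat x : set 'rV[R]_n :=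
  [set z | in_apt z /\ forall psi, is_affroot psi ->
     affeval psi x = r -> affeval psi z = r].

Lemma cell_refl x : in_apt x -> cell x x. Proof. by []. Qed.

Lemma flat_refl x : in_apt x -> flat x x. Proof. by []. Qed.

Lemma sgr_subr_eq0 (a : R) : (Num.sg (a - r) == 0) = (a == r).
Proof. by rewrite sgr_eq0 subr_eq0. Qed.

Lemma cell_sub_flat x : cell x `<=` flat x.
Proof.
move=> z [zA xz]; split=> // psi p e; apply/eqP.
by rewrite -sgr_subr_eq0 xz// e subrr sgr0.
Qed.

Lemma affeval_line psi x y t :
  affeval psi ((1 - t) *: x + t *: y) =
  (1 - t) * affeval psi x + t * affeval psi y.
Proof. by rewrite /affeval !mxE; ring. Qed.

Lemma in_apt_line x y t :
  in_apt x -> in_apt y -> in_apt ((1 - t) *: x + t *: y).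
Proof.
move=> /eqP xA /eqP yA; apply/eqP.
under eq_bigr do rewrite !mxE.
by rewrite big_split /= -!mulr_sumr xA yA !mulr0 addr0.
Qed.

Lemma affeval_continuous psi : continuous (@affeval R n psi).
Proof.
move=> x.
have c i : {for x, continuous (fun y : 'rV[R]_n => y 0 i)}.
  exact: coord_continuous.
have := continuousD (continuousB (c psi.1.1) (c psi.1.2))
  (@cst_continuous _ _ (psi.2%:~R : R) x).
exact.
Qed.

Lemma line_continuous x y :
  continuous (fun t : R => (1 - t) *: x + t *: y : 'rV[R]_n).
Proof.
move=> t; apply: cvgD; apply: cvgZ;
  [|exact: cvg_cst|exact: cvg_id|exact: cvg_cst].
by apply: cvgB; [exact: cvg_cst|exact: cvg_id].
Qed.

(** There are infinitely many affine roots but finitely many gradients, so some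
    positive step works for all of them at once. *)
Lemma small_move_sgr x v : exists2 d : R, 0 < d <= 1 & forall psi,
  affeval psi x != r ->
  Num.sg (affeval psi (x + d *: v) - r) = Num.sg (affeval psi x - r).
Proof.
have gap (p : 'I_n * 'I_n) := cid2 (int_translates_gap (x 0 p.1 - x 0 p.2 - r)).
pose e p := projT1 (gap p).
pose w (p : 'I_n * 'I_n) := v 0 p.1 - v 0 p.2.
have w0 p : 0 < 1 + `|w p| by rewrite ltr_pwDl.
pose d := \big[Num.min/1]_p (e p / (1 + `|w p|)).
have e0 p : 0 < e p by rewrite /e; case: (gap p).
have d0 : 0 < d.
  by apply: lt_bigmin => // p _; rewrite divr_gt0.
exists d => [|[[i j] m] /=]; first by rewrite d0 bigmin_le_id.
move=> px; pose p := (i, j).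
have -> : affeval (i, j, m) (x + d *: v) - r =
    (affeval (i, j, m) x - r) + d * w p by rewrite /affeval /w !mxE /=; ring.
apply: sgr_addl_small; apply: (@lt_le_trans _ _ (e p)).
  rewrite normrM gtr0_norm//.
  have : d <= e p / (1 + `|w p|) by exact: bigmin_le.
  rewrite ler_pdivlMr// mulrDr mulr1; have := d0; lra.
have -> : affeval (i, j, m) x - r = x 0 i - x 0 j - r + m%:~R.
  by rewrite /affeval /=; ring.
rewrite /e; case: (gap p) => /= q _; apply.
by apply: contra px => /eqP E; rewrite /affeval /= -subr_eq0 -E; apply/eqP;
  ring.
Qed.

Lemma cell_convex x z t : cell x z -> 0 <= t <= 1 -> in_apt x ->
  cell x ((1 - t) *: x + t *: z).
Proof.
move=> [zA xz] t01 xA; split=> [|psi p]; first exact: in_apt_line.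
rewrite affeval_line -(sgr_convex t01 (xz _ p)); congr Num.sg; ring.
Qed.

Lemma flat_affine x : is_affine (flat x).
Proof.
move=> y z t [yA xy] [zA xz]; split=> [|psi p e]; first exact: in_apt_line.
by rewrite affeval_line xy// xz//; ring.
Qed.

(** Any [z] in the flat lies on the line through [x] and a point of the cell
    close to [x] in the direction of [z]. *)
Lemma aff_cell x : in_apt x -> aff (cell x) = flat x.
Proof.
move=> xA; apply/seteqP; split=> [z|z [zA xz] U [Uaff UA cU]].
  apply; split; [exact: flat_affine|by move=> y []|exact: cell_sub_flat].
have [d /andP[d0 d1] dP] := small_move_sgr x (z - x).
have yE : x + d *: (z - x) = (1 - d) *: x + d *: z.
  by apply/rowP => i; rewrite !mxE; ring.
have cy : cell x (x + d *: (z - x)).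
  split=> [|psi p]; first by rewrite yE; exact: in_apt_line.
  have [e|] := eqVneq (affeval psi x) r; last exact: dP.
  by rewrite yE affeval_line xz// e; congr Num.sg; ring.
have -> : z = (1 - d^-1) *: x + d^-1 *: (x + d *: (z - x)).
  by apply/rowP => i; rewrite !mxE; field; rewrite gt_eqF.
by apply: Uaff; apply: cU => //; exact: cell_refl.
Qed.

(** On a connected component an affine root that avoids the value [r] stays on
    one side of it; conversely the cell is convex, hence connected.  The set
    [Sigma] is determined by [x]: it contains the affine roots with value [r]
    at [x] and no others. *)
Lemma component_cell (Sigma : set (affroot n)) x : facet_locus r Sigma x ->
  connected_component (facet_locus r Sigma) x = cell x.
Proof.
move=> lx; have [[/= xA xS] xNS] := lx.
have SigmaP psi : is_affroot psi -> affeval psi x = r -> Sigma psi.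
  by move=> p e; apply: contrapT => N; apply: xNS; exists psi.
apply/seteqP; split=> y.
  move=> Cy; have /connected_component_sub[[/= yA yS] _] := Cy.
  split=> // psi p.
  have [Sp|NSp] := pselect (Sigma psi).
    by have [_ ->] := yS _ Sp; have [_ ->] := xS _ Sp.
  have : connected (affeval psi @` connected_component (facet_locus r Sigma) x).
    apply: connected_continuous_connected; first exact: component_connected.
    exact/(continuous_subspaceT (@affeval_continuous psi)).
  move/connected_intervalP => I.
  have NI : ~ (affeval psi @` connected_component (facet_locus r Sigma) x) r.
    move=> [z /connected_component_sub[[/= zA _] NU] zr].
    by apply: NU; exists psi.
  have Iy : (affeval psi @` connected_component (facet_locus r Sigma) x)
    (affeval psi y) by exists y.
  have Ix : (affeval psi @` connected_component (facet_locus r Sigma) x)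
    (affeval psi x).
    by exists x => //; exact: connected_component_refl.
  have [xr|xr|xr] := ltgtP (affeval psi x) r; last by case: NI;
    rewrite xr in Ix.
    have [yr|yr|yr] := ltgtP (affeval psi y) r; last by case: NI;
      rewrite yr in Iy.
      by rewrite !ltr0_sg ?subr_lt0//.
    by case: NI; apply: I Ix Iy _ _; rewrite (ltW xr) (ltW yr).
  have [yr|yr|yr] := ltgtP (affeval psi y) r; last by case: NI;
    rewrite yr in Iy.
    by case: NI; apply: I Iy Ix _ _; rewrite (ltW xr) (ltW yr).
  by rewrite !gtr0_sg ?subr_gt0//.
move=> cy; pose l := fun t : R => (1 - t) *: x + t *: y.
have l0 : l 0 = x by rewrite /l subr0 scale1r scale0r addr0.
have l1 : l 1 = y by rewrite /l subrr scale1r scale0r add0r.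
apply: (@connected_component_max _ _ (l @` `[0, 1]%classic)).
- by exists 0 => //=; rewrite in_itv /= lexx ler01.
- move=> _ [t /= + <-]; rewrite in_itv /= => t01.
  have [zA xz] := cell_convex cy t01 xA.
  split=> [|[psi [p NS] [_ e]]].
    split=> //= psi Sp; split=> //.
    have [_ px] := xS _ Sp.
    have [p|Np] := boolP (is_affroot psi).
      by apply/eqP; rewrite -sgr_subr_eq0 xz// px subrr sgr0.
    by move: px; rewrite /affeval; move/negPn/eqP: Np => ->; rewrite !subrr.
  apply: NS; apply: SigmaP => //.
  by apply/eqP; rewrite -sgr_subr_eq0 -xz// e subrr sgr0.
- apply: connected_continuous_connected; first exact: segment_connected.
  exact/(continuous_subspaceT (@line_continuous x y)).
- by exists 1 => //=; rewrite in_itv /= lexx ler01.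
Qed.

Lemma is_facetP (F : set 'rV[R]_n) :
  is_facet r F <-> exists2 x, in_apt x & F = cell x.
Proof.
split=> [[Sigma [_ _ [x lx ->]]]|[x xA ->]].
  by exists x; [have [[]] := lx|exact: component_cell].
pose Sigma : set (affroot n) :=
  [set psi | is_affroot psi /\ affeval psi x = r].
have lx : facet_locus r Sigma x.
  split=> [|[psi [/= p NS] [_ e]]]; last exact: NS.
  by split=> // psi [_ e].
exists Sigma; split=> [|psi []//|]; last by exists x => //;
  rewrite component_cell.
(* A gradient determines at most one constant term giving the value r at x. *)
apply: (@sub_finite_set _ _ [set (p, Num.floor (r - x 0 p.1 + x 0 p.2)) | p in
  [set: 'I_n * 'I_n]]); last exact/finite_image/finite_finset.
move=> [p m] [_ /= e]; exists p => //; congr pair.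
have -> : r - x 0 p.1 + x 0 p.2 = m%:~R by rewrite -e /affeval /=; ring.
exact: intrKfloor.
Qed.

End Cells.

(** * Dimensions and facets of maximal dimension *)

Section Dimension.
Variables (R : realType) (n : nat).
Implicit Types (a b v : 'rV[R]_n) (V W : {vspace 'rV[R]_n}).

Definition affspace a V : set 'rV[R]_n := [set a + v | v in [set` V]].

Lemma affspace_subP a b V W : affspace a V `<=` affspace b W -> (V <= W)%VS.
Proof.
move=> ab; have [w0 /= W0 E0] : affspace b W a by apply: ab; exists 0;
  rewrite ?addr0 //= mem0v.
apply/subvP => v Vv; have [w /= Ww E] : affspace b W (a + v) by apply: ab;
  exists v.
have -> : v = w - w0 by apply: (addrI a); rewrite -E -E0; apply/rowP => i;
  rewrite !mxE; ring.
exact: rpredB.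
Qed.

(** The dimension is well defined because an affine space determines its
    direction. *)
Lemma affdim_affspace a V : affdim (affspace a V) = \dim V.
Proof.
rewrite /affdim; set P := (X in get X).
have [|b [W [E <-]]] := @getPex _ P; first by exists (\dim V), a, V.
have {}E : affspace a V = affspace b W by exact: E.
apply/eqP; rewrite eqn_leq.
by rewrite !dimvS//;
  [apply: (@affspace_subP a b)|apply: (@affspace_subP b a)]; rewrite E.
Qed.

Lemma affspace_sub_eq a b V W : affspace a V `<=` affspace b W ->
  (\dim W <= \dim V)%N ->
  affspace a V = affspace b W.
Proof.
move=> ab d; have VW : V = W.
  by apply/eqP; rewrite eqEdim d (affspace_subP ab).
subst W.
have [w0 /= W0 E0] : affspace b V a by apply: ab; exists 0;
  rewrite ?addr0 //= mem0v.
apply/seteqP; split=> // _ [w /= Ww <-]; exists (w - w0); first exact: rpredB.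
by rewrite -E0; apply/rowP => i; rewrite !mxE; ring.
Qed.

End Dimension.

Section FlatDimension.
Variables (R : realType) (n : nat) (r : R).
Implicit Types (x y z : 'rV[R]_n).

(** A linear map whose kernel is the direction of the flat through [x]: the
    diagonal entries impose a zero sum of coordinates, the entry [(i, j)]
    imposes the equation of the wall of gradient e_i - e_j through [x], if there
    is one. *)
Definition flat_mx x (v : 'rV[R]_n) : 'M[R]_n := \matrix_(i, j)
  if i == j then \sum_l v 0 l
  else if `[< exists m, affeval (i, j, m) x = r >] then v 0 i - v 0 j else 0.

Fact flat_mx_is_linear x : linear (flat_mx x).
Proof.
move=> t u v; apply/matrixP => i j; rewrite !mxE.
case: eqP => _.
  by rewrite mulr_sumr -big_split /=; apply: eq_bigr => l _; rewrite !mxE.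
by case: ifP => _; rewrite ?mxE; ring.
Qed.
HB.instance Definition _ x :=
  GRing.isLinear.Build R 'rV[R]_n 'M[R]_n _ (flat_mx x)
  (flat_mx_is_linear x).

Definition flat_dir x : {vspace 'rV[R]_n} := lker (linfun (flat_mx x)).

Lemma flat_affspace x : in_apt x -> flat r x = affspace x (flat_dir x).
Proof.
move=> xA; apply/seteqP; split=> [z [zA xz]|_ [v /= + <-]].
  exists (z - x); last by rewrite addrC subrK.
  rewrite /= memv_ker lfunE /=; apply/eqP/matrixP => i j; rewrite !mxE.
  case: eqP => [_|/eqP ij].
    under eq_bigr do rewrite !mxE.
    by rewrite big_split /= sumrN (eqP zA) (eqP xA) subrr.
  case: asboolP => // -[m e]; have := xz (i, j, m) ij e; rewrite -e /affeval /=.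
  by lra.
rewrite memv_ker lfunE /= => /eqP/matrixP E; split=> [|[[i j] m] /= ij e].
  rewrite /in_apt; under eq_bigr do rewrite mxE.
  rewrite big_split /= (eqP xA) add0r.
  have [i _|n0] := pickP (fun _ : 'I_n => true); last by rewrite big_pred0.
  by have := E i i; rewrite !mxE eqxx => ->.
have := E i j; rewrite !mxE (negbTE ij); case: asboolP => [_|[]];
  last by exists m.
by move: e; rewrite /affeval /= !mxE; lra.
Qed.

Lemma fdim_cell x : in_apt x -> fdim (cell r x) = \dim (flat_dir x).
Proof.
by move=> xA; rewrite /fdim aff_cell// flat_affspace// affdim_affspace.
Qed.

Lemma flat_sub_eq x y : in_apt x -> in_apt y -> flat r x `<=` flat r y ->
  (fdim (cell r y) <= fdim (cell r x))%N -> flat r x = flat r y.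
Proof.
move=> xA yA; rewrite !fdim_cell// !flat_affspace//; exact: affspace_sub_eq.
Qed.

End FlatDimension.

Section SimpleFlats.
Variables (R : realType) (n : nat) (r : R) (S : {set 'I_n.-1}).
Variable c : 'I_n.-1 -> int.
Implicit Types (x y z v w : 'rV[R]_n).

Lemma is_affroot_simple (i : 'I_n.-1) m : is_affroot (simple i m).
Proof. by rewrite /is_affroot /simple -val_eqE /= ltn_eqF. Qed.

Lemma flat_sub_simple x : simple_flat r S c x ->
  flat r x `<=` simple_flat r S c.
Proof.
move=> [/= xA xS] z [zA xz]; split=> // i Si; split=> //.
by apply: xz; [exact: is_affroot_simple|case: (xS i Si)].
Qed.

(** The rank of the interval containing [j]: as a coordinate vector it is
    constant on the intervals and separates distinct ones. *)
Definition gaps (j : nat) : nat := \sum_(i < n.-1 | (i < j)%N) (i \notin S).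

Lemma gapsS (i : 'I_n.-1) : gaps i.+1 = (gaps i + (i \notin S))%N.
Proof.
rewrite /gaps (bigD1 i) //= addnC; congr (_ + _)%N; apply: eq_bigl => j.
by rewrite ltnS [RHS]ltn_neqAle andbC -val_eqE.
Qed.

Lemma gaps_homo : {homo gaps : i j / (i <= j)%N}.
Proof.
move=> i j ij; rewrite /gaps big_mkcond [leqRHS]big_mkcond /=.
apply: leq_sum => l _; case: ifP => // li; by rewrite (leq_trans li ij).
Qed.

(** Equal values of [gaps] mean that all indices in between belong to [S]. *)
Lemma gaps_eq (w : 'rV[R]_n) :
  (forall i, i \in S -> w 0 (simple i 0).1.1 = w 0 (simple i 0).1.2) ->
  forall i j : 'I_n, gaps i = gaps j -> w 0 i = w 0 j.
Proof.
move=> wS; suff H (d : nat) (i j : 'I_n) : j = (i + d)%N :> nat ->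
  gaps i = gaps j ->
    w 0 i = w 0 j.
  move=> i j; have [ij|/ltnW ij] := leqP i j.
    by apply: (H (j - i)%N); rewrite subnKC.
  by move=> E; apply/esym; apply: (H (i - j)%N); rewrite ?subnKC.
elim: d j => [|d IH] j ji E; first by congr (w 0 _); apply: val_inj;
  rewrite /= ji addn0.
have jn : ((i + d).+1 < n)%N by rewrite -addnS -ji.
pose l := Ordinal (ltnW jn).
have ln : (l < n.-1)%N by rewrite /= -subn1; lia.
have El : gaps i = gaps l.
  apply/eqP; rewrite eqn_leq gaps_homo ?leq_addr// E gaps_homo//=; lia.
rewrite (IH l)//; have := gapsS (Ordinal ln);
  have -> : (Ordinal ln).+1 = j :> nat.
  by rewrite /= ji addnS.
rewrite -E El -[LHS]addn0 => /addnI; case: (boolP (_ \in S)) => // /wS E' _.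
transitivity (w 0 (simple (Ordinal ln) 0).1.1); first by congr (w 0 _);
  apply: val_inj.
by rewrite E'; congr (w 0 _); apply: val_inj; rewrite /= ji addnS.
Qed.

(** Moving slightly along [gaps], recentred to have zero sum, stays in the flat
    and leaves every wall whose gradient is not constant on it. *)
Lemma simple_flat_generic x : simple_flat r S c x ->
  exists2 y, in_apt y & flat r y = simple_flat r S c.
Proof.
move=> Lx; have [/= xA xS] := Lx.
pose mean : R := (\sum_(l < n) (gaps l)%:R) / n%:R.
pose v : 'rV[R]_n := \row_i ((gaps i)%:R - mean).
have vE i : v 0 i = (gaps i)%:R - mean by rewrite mxE.
have vA : \sum_i v 0 i = 0.
  under eq_bigr do rewrite vE.
  rewrite big_split /= sumrN sumr_const card_ord /mean -[X in _ - X]mulr_natr.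
  have [->|n0] := eqVneq n 0%N; first by rewrite mulr0 subr0 big_ord0.
  by rewrite divfK ?subrr// pnatr_eq0.
clearbody v; have [d /andP[d0 _] dP] := small_move_sgr r x v.
pose y := x + d *: v.
have yA : in_apt y.
  apply/eqP; rewrite /y; under eq_bigr do rewrite !mxE.
  by rewrite big_split /= -mulr_sumr vA mulr0 addr0 (eqP xA).
have Ly : simple_flat r S c y.
  split=> //= i Si; split=> //; have [_ <-] := xS i Si;
    have Si' : i \in S := Si.
  have /= gE := gapsS i; rewrite Si' addn0 in gE.
  by rewrite /affeval /y !mxE !vE /= gE; ring.
exists y => //; apply/seteqP; split; first exact: flat_sub_simple.
move=> z [/= zA zS]; split=> // -[[i j] m] /= ij ey.
have ex : affeval (i, j, m) x = r.
  apply: contrapT => /eqP N; have := dP _ N; rewrite ey subrr sgr0.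
  by move=> /esym/eqP; rewrite sgr_subr_eq0 (negbTE N).
have : d * ((gaps i)%:R - (gaps j)%:R) = 0 :> R.
  by move: ey ex; rewrite /affeval /y /= !mxE !vE; lra.
move/eqP; rewrite mulf_eq0 gt_eqF//= subr_eq0 eqr_nat => /eqP gij.
have zx : (z - x) 0 i = (z - x) 0 j.
  apply: gaps_eq gij => l Sl; rewrite !mxE.
  have [_] := zS l Sl; have [_] := xS l Sl; rewrite /affeval /=; lra.
by move: zx ex; rewrite !mxE /affeval /=; lra.
Qed.

(** The cell of a generic point competes with the given facet, so the latter
    cannot span a proper subset. *)
Lemma flat_max_facet x : in_apt x ->
  max_facet_in r (simple_flat r S c) (cell r x) ->
  flat r x = simple_flat r S c.
Proof.
move=> xA [_ xL max]; have Lx : simple_flat r S c x by apply: xL;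
  exact: cell_refl.
have [y yA Ey] := simple_flat_generic Lx.
rewrite -Ey; apply: flat_sub_eq => //; first by rewrite Ey;
  exact: flat_sub_simple.
apply: max; first by apply/is_facetP; exists y.
by rewrite -Ey; exact: cell_sub_flat.
Qed.

End SimpleFlats.

(** * Generalized facets and the action of monomial matrices *)

Section Uniformizer.
Variable k : localField.

Lemma nu_exprz (x : k) (m : int) : x != 0 -> nu (x ^ m) = m * nu x.
Proof.
move=> x0; have N q : nu (x ^+ q) = q%:Z * nu x.
  elim: q => [|q IH]; first by rewrite expr0 nu1 mul0r.
  by rewrite exprS nuM ?expf_neq0// IH; lia.
case: m => q; first exact: N.
by rewrite NegzE -[_ ^ _]/((x ^+ q.+1)^-1) nuV ?expf_neq0// N mulNr.
Qed.

Lemma nu_surj (m : int) : exists2 x : k, x != 0 & nu x = m.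
Proof.
have [p p0 pv] := nu_unif k.
by exists (p ^ m); rewrite ?expfz_neq0// nu_exprz// pv mulr1.
Qed.

End Uniformizer.

Section GeneralizedFacets.
Variables (R : realType) (k : localField) (n : nat) (r : R).
Implicit Types (x y z : apt R n) (g h : SL k n) (b : building R k n).

Lemma above_nu_affeval (s : bool) (z : 'rV[R]_n) (i j : 'I_n) (a : k) :
  a != 0 ->
  above s (r - (z 0 i - z 0 j)) (nue R a) =
  if s then r < affeval (i, j, nu a) z else r <= affeval (i, j, nu a) z.
Proof.
move=> a0; rewrite above_nue (negbTE a0) /affeval /=.
by case: s; rewrite ?ltrBlDl ?lerBlDl.
Qed.

Lemma mp_lat_delta (s : bool) (z : 'rV[R]_n) (i j : 'I_n) (a : k) : i != j ->
  a != 0 ->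
  mp_lat s r z (a *: delta_mx i j) <->
  (if s then r < affeval (i, j, nu a) z else r <= affeval (i, j, nu a) z).
Proof.
move=> ij a0; rewrite -above_nu_affeval// mp_latP; split=> [[_ /(_ i j)]|H].
  by rewrite !mxE !eqxx mulr1.
split=> [|u v].
  by rewrite mxtraceZ /mxtrace big1 ?mulr0// => l _; rewrite mxE;
    case: eqP => //= ->; rewrite (negbTE ij).
rewrite !mxE; case: eqP => [->|_]; last by rewrite mulr0 above_nue eqxx.
by case: eqP => [->|_]; rewrite ?mulr1// mulr0 above_nue eqxx.
Qed.

Lemma sgr_ltle (a : R) :
  Num.sg (a - r) = if r < a then 1 else if r <= a then 0 else -1.
Proof.
case: ltgtP => h; first by rewrite gtr0_sg ?subr_gt0.
  by rewrite ltr0_sg ?subr_lt0.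
by rewrite h subrr sgr0.
Qed.

(** One direction tests the lattices on multiples of elementary matrices, the
    other compares them entry by entry; diagonal entries do not depend on the
    point. *)
Lemma mp_lat_cell (x z : 'rV[R]_n) : in_apt z ->
  (forall s, mp_lat s r x = mp_lat s r z :> set 'M[k]_n) <-> cell r x z.
Proof.
move=> zA; split=> [E|[_ xz] s].
  split=> // -[[i j] m] ij; have [a a0 <-] := nu_surj k m.
  have H s :
    (if s then r < affeval (i, j, nu a) z else r <= affeval (i, j, nu a) z) =
    (if s then r < affeval (i, j, nu a) x else r <= affeval (i, j, nu a) x).
    have X := mp_lat_delta s x ij a0; have Z := mp_lat_delta s z ij a0.
    by rewrite E in X; apply/idP/idP => ?; [apply/X/Z|apply/Z/X].
  by rewrite !sgr_ltle (H true) (H false).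
have one i j (a : k) : above s (r - (x 0 i - x 0 j)) (nue R a) =
    above s (r - (z 0 i - z 0 j)) (nue R a).
  have [->|a0] := eqVneq a 0; first by rewrite !above_nue eqxx.
  have [<-|ij] := eqVneq i j; first by rewrite !subrr.
  have e := xz (i, j, nu a) ij; rewrite !above_nu_affeval//.
  case: s; first by rewrite -subr_gt0 -sgr_gt0 -e sgr_gt0 subr_gt0.
  by rewrite -subr_ge0 -sgr_ge0 -e sgr_ge0 subr_ge0.
apply/seteqP; split=> X /mp_latP[tX eX]; apply/mp_latP; split=> // i j.
  by rewrite -one.
by rewrite one.
Qed.

Lemma Ad1 : Ad (SL1 k n) = id.
Proof. by apply/funext => X; rewrite /Ad /= invmx1 mul1mx mulmx1. Qed.

Lemma gfacet_preimage x :
  val @` (bpoint (SL1 k n) @^-1` gfacet r (bpoint (SL1 k n) x)) =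
    cell r (val x).
Proof.
have E s (z : apt R n) : mp_bld s r (bpoint (SL1 k n) z) = mp_lat s r (val z).
  by rewrite mp_bld_bpoint Ad1 image_id.
apply/seteqP; split=> [_ [z [/= E0 E1] <-]|z xz].
  apply/mp_lat_cell; first exact: (valP z).
  by case; rewrite -!E.
have zA : in_apt z by case: xz.
exists (Sub z zA) => //; rewrite /= /gfacet /= !E /=.
by split; have /mp_lat_cell := xz => /(_ zA) ->.
Qed.

Lemma cell_sub_gfacet x :
  bpoint (SL1 k n) @` (val @^-1` cell r (val x)) `<=`
  gfacet r (bpoint (SL1 k n) x).
Proof.
move=> _ [z /= xz <-]; rewrite -gfacet_preimage in xz.
by case: xz => z' H /val_inj <-.
Qed.

Lemma baff_gfacet x : baff (SL1 k n) (gfacet r (bpoint (SL1 k n) x)) =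
  bpoint (SL1 k n) @` (val @^-1` flat r (val x)).
Proof. by rewrite /baff gfacet_preimage aff_cell//; exact: (valP x). Qed.

Fact SLV_subproof g : \det (invmx (val g)) == 1.
Proof. by rewrite det_inv SLP invr1. Qed.
Definition SLV g : SL k n := Sub (invmx (val g)) (SLV_subproof g).

Lemma bpoint_repr b : exists h x, b = bpoint h x.
Proof.
exists (repr b).1, (repr b).2.
by rewrite /bpoint -surjective_pairing reprK.
Qed.

Lemma bactKV g b : bact g (bact (SLV g) b) = b.
Proof.
have [h [x ->]] := bpoint_repr b; rewrite !bact_bpoint; congr bpoint.
by apply: val_inj; rewrite /= mulKVmx// det_unit// SLP.
Qed.

Lemma Ad_inj g : injective (Ad g).
Proof.
move=> X Y; rewrite /Ad => E; have gu := det_unit (SLP g).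
apply: (can_inj (mulKmx gu));
  apply: (can_inj (mulmxK (_ : invmx (val g) \in unitmx))) => //.
by rewrite unitmx_inv.
Qed.

Lemma AdM g h : Ad (SLM g h) = Ad g \o Ad h.
Proof.
apply/funext => X; rewrite /Ad /=.
have gu := det_unit (SLP g); have hu := det_unit (SLP h).
have ghu : val g *m val h \in unitmx by rewrite unitmx_mul gu.
apply: (can_inj (mulmxK ghu)); rewrite (mulmxKV ghu) !mulmxA.
by rewrite (mulmxKV gu) (mulmxKV hu).
Qed.

Lemma mp_bld_bact s g b : mp_bld s r (bact g b) = Ad g @` mp_bld s r b.
Proof.
have [h [x ->]] := bpoint_repr b.
by rewrite bact_bpoint !mp_bld_bpoint AdM image_comp.
Qed.

Lemma image_Ad_inj g (A B : set 'M[k]_n) : Ad g @` A = Ad g @` B -> A = B.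
Proof.
suff H (C D : set 'M[k]_n) : Ad g @` C = Ad g @` D -> C `<=` D.
  by move=> E; apply/seteqP; split; apply: H.
move=> E X CX; have [Y DY /Ad_inj <- //] : (Ad g @` D) (Ad g X) by rewrite -E;
  exists X.
Qed.

(** Generalized facets are defined by lattices on which the group acts
    compatibly through the adjoint representation. *)
Lemma gfacet_bact g b : bact g @` gfacet r b = gfacet r (bact g b).
Proof.
apply/seteqP; split=> [_ [b' [E0 E1] <-]|b' [E0 E1]].
  by split; rewrite !mp_bld_bact ?E0 ?E1.
exists (bact (SLV g) b'); last exact: bactKV.
by split; apply: (@image_Ad_inj g); rewrite -!mp_bld_bact bactKV.
Qed.

(** The normalizer of the torus stabilizes the standard apartment and acts on
    it through [mon_act]. *)
Lemma bpoint_monomial g x y : monomial (val g) ->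
  mon_act (val g) (val x) = val y ->
  bpoint g x = bpoint (SL1 k n) y.
Proof.
move=> mg gx; apply/bpointP/asboolP; exists (val g); split=> //=.
by rewrite mulmx1 mulVmx ?det_unit ?SLP//; exact: Ugrp1.
Qed.

(** The standard apartment serves as common apartment: after moving by [g], both
    generalized facets have the same span there. *)
Lemma facet_associate_monomial g x y z :
  monomial (val g) -> mon_act (val g) (val y) = val z ->
  flat r (val x) = flat r (val z) ->
  facet_associate k r (cell r (val x)) (cell r (val y)).
Proof.
move=> mg gy E; exists (bpoint (SL1 k n) x), (bpoint (SL1 k n) y).
split; [exact: cell_sub_gfacet|exact: cell_sub_gfacet|].
exists g, (SL1 k n); rewrite gfacet_bact bact_bpoint.
have -> : SLM g (SL1 k n) = g by apply: val_inj; rewrite /= mulmx1.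
rewrite (bpoint_monomial mg gy) !baff_gfacet E; split=> //.
by exists (bpoint (SL1 k n) z), z => //=; apply: flat_refl; exact: (valP z).
Qed.

(** The diagonal matrix of powers of a uniformizer with exponents [t]; the zero
    sum makes its determinant 1. *)
Lemma translation_exists (t : 'I_n -> int) : \sum_i t i = 0 ->
  exists2 g : SL k n, monomial (val g) &
  forall x : 'rV[R]_n, mon_act (val g) x = \row_i (x 0 i - (t i)%:~R).
Proof.
move=> t0.
have [p p0 pv] := nu_unif k.
pose d := \row_i p ^ t i; pose w := diag_mx d : 'M[k]_n.
have dw : \det w == 1.
  rewrite det_diag; under eq_bigr do rewrite mxE.
  have expD (u v : int) : p ^ (u + v) = p ^ u * p ^ v by exact: expfzDr.
  by rewrite -(big_morph (fun m : int => p ^ m) expD (expr0z p)) t0 expr0z.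
have w0 i : p ^ t i != 0 by rewrite expfz_neq0.
have ws i j : (w i j != 0) = (i == (1%g : 'S_n) j).
  by rewrite /w !mxE perm1; case: (i =P j) => [_|_];
    rewrite ?mulr1n ?w0// mulr0n eqxx.
exists (Sub w dw) => [|x]; first by split; [exact/eqP|exists 1%g].
apply/rowP => i; have := mon_actE x ws i; rewrite perm1 => ->.
rewrite /w !mxE eqxx mulr1n; congr (_ - _%:~R).
by rewrite nu_exprz// pv mulr1.
Qed.

End GeneralizedFacets.

(** * The translation vector *)

(** The double sum visits, interval by interval, every index other than the last
    one of its interval. *)
Lemma sum_between_ends (f : nat -> int) (a : nat) (E : seq nat) :
  path ltn a E ->
  let lam := pairmap (fun a b => (b - a)%N) a E in
  \sum_(0 <= l < size lam) \sum_(1 <= j < nth 0%N lam l)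
     f (a + \sum_(0 <= m < l) nth 0%N lam m + j - 1)%N =
  \sum_(a <= i < last a E | i.+1 \notin E) f i.
Proof.
elim: E a => [a _ /=|e E IH a /= /andP[ae eE]].
  by rewrite !big_geq.
have eL : (e <= last e E)%N.
  have := eE; rewrite (path_sortedE ltn_trans) => /andP[/allP eall _].
  by have := mem_last e E; rewrite inE => /orP[/eqP ->//|/eall /ltnW].
rewrite big_nat_recl// (@big_cat_nat _ _ _ e a (last e E) _ f (ltnW ae) eL) /=.
congr (_ + _).
  transitivity (\sum_(1 <= j < e - a) f (a + j - 1)%N).
    by apply: eq_bigr => j _; rewrite big_geq// addn0.
  case: e ae eE {IH eL} => // e ae eE.
  rewrite [RHS]big_mkcond [RHS]big_nat_recr//= inE eqxx addr0 big_add1.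
  have -> : \sum_(0 <= j < (e.+1 - a).-1) f (a + j.+1 - 1)%N =
    \sum_(a <= i < e) f i.
    rewrite -[X in _ = \sum_(X <= _ < _) _]add0n big_addn subSn//=.
    by apply: eq_bigr => j _; congr f; lia.
  apply: eq_big_nat => i /andP[_ ie]; rewrite ifT// inE eqSS ltn_eqF//=.
  apply/negP => /(allP (order_path_min ltn_trans eE)) /=; lia.
transitivity (\sum_(e <= i < last e E | i.+1 \notin E) f i).
  rewrite -IH//=; apply: eq_bigr => l _; apply: eq_bigr => j _; congr f.
  by rewrite big_nat_recl//=; lia.
rewrite [LHS]big_nat_cond [RHS]big_nat_cond; apply: eq_bigl => i.
by rewrite inE; case: eqP => // <-; rewrite ltnn.
Qed.

Section Ends.
Variables (n : nat) (S : {set 'I_n.-1}).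
Hypothesis n_gt1 : (1 < n)%N.

Definition ends : seq nat := rcons [seq (nat_of_ord i).+1 | i <- enum (~: S)] n.

Lemma ends_path : path ltn 0 ends.
Proof.
rewrite /ends rcons_path; apply/andP; split.
  rewrite (path_sortedE ltn_trans); apply/andP; split.
    by apply/allP => _ /mapP[i _ ->].
  rewrite sorted_map -[sorted _ _]/(sorted (relpre val ltn) _) -sorted_map.
  apply: (subseq_sorted ltn_trans _ (iota_ltn_sorted 0 n.-1)).
  rewrite -val_enum_ord map_subseq//.
  have -> : enum (~: S) = [seq i <- enum 'I_n.-1 | i \in ~: S] by rewrite enumT.
  exact: filter_subseq.
case/lastP: (enum _) => [|s x]; first by rewrite /=; lia.
rewrite map_rcons last_rcons; have := ltn_ord x; lia.
Qed.

Lemma mem_ends_ord (i : 'I_n.-1) : (i.+1 \in ends) = (i \notin S).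
Proof.
rewrite /ends mem_rcons inE ltn_eqF; last by have := ltn_ord i; lia.
have -> : (i \notin S) = (i \in enum (~: S)) by rewrite mem_enum inE.
by rewrite (mem_map (f := fun u : 'I_n.-1 => u.+1)) // => u v [/val_inj].
Qed.

Lemma n_in_ends : n \in ends.
Proof. by rewrite /ends mem_rcons inE eqxx. Qed.

Lemma sum_notin_ends (f : nat -> int) :
  \sum_(0 <= i < n | i.+1 \notin ends) f i = \sum_(i in S) f i.
Proof.
rewrite big_mkcond -[X in \sum_(_ <= _ < X) _](prednK (ltnW n_gt1)).
rewrite big_nat_recr//= (prednK (ltnW n_gt1)) n_in_ends addr0.
rewrite big_mkord [RHS]big_mkcond /=; apply: eq_bigr => i _.
by rewrite mem_ends_ord negbK.
Qed.

(** The sums of the sequences that can be added to a solution of the difference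
    equations on [S] without changing the differences. *)
Definition attainable (m : int) := exists2 t : nat -> int,
  (forall i, i \in S -> t (nat_of_ord i) = t (nat_of_ord i).+1) &
  \sum_(i < n) t i = m.

Lemma attainable_comb (u v a b : int) :
  attainable a -> attainable b -> attainable (u * a + v * b).
Proof.
move=> [t tS <-] [t' tS' <-]; exists (fun i => u * t i + v * t' i).
  by move=> i Si; rewrite tS// tS'.
by rewrite big_split /= -!mulr_sumr.
Qed.

(** The indicator of an initial segment ending where an interval ends is
    constant on every interval. *)
Lemma attainable_end e : e \in ends -> attainable e%:Z.
Proof.
move=> eE; exists (fun i => (i < e)%N : int) => [i Si|].
  congr (_%:Z); congr nat_of_bool; rewrite [RHS]ltn_neqAle.
  by case: eqP => // ie; move: eE; rewrite -ie mem_ends_ord Si.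
have en : (e <= n)%N.
  move: eE; rewrite /ends mem_rcons inE => /orP[/eqP->//|/mapP[i _ ->]].
  by have := ltn_ord i; lia.
rewrite -(big_morph Posz PoszD (erefl _)); congr (_%:Z).
rewrite -[RHS]card_ord -sum1_card (big_ord_widen n (fun _ => 1%N) en).
by rewrite [RHS]big_mkcond /=; apply: eq_bigr => i _; case: ltnP.
Qed.

Definition ends_gcd : nat := \big[gcdn/0%N]_(e <- ends) e.

Lemma dvdn_biggcd d (s : seq nat) :
  (d %| \big[gcdn/0%N]_(e <- s) e)%N = all (dvdn d) s.
Proof.
by elim: s => [|e s IH]; rewrite ?big_nil ?dvdn0// big_cons dvdn_gcd IH.
Qed.

Lemma ends_gcd_dvd : all (dvdn ends_gcd) ends.
Proof. by rewrite -dvdn_biggcd. Qed.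

(** Attainable sums form a subgroup of the integers, so by Bezout they include
    every multiple of the gcd of the interval ends. *)
Lemma attainable_dvd (m : int) : (ends_gcd%:Z %| m)%Z -> attainable m.
Proof.
have : attainable ends_gcd%:Z.
  rewrite /ends_gcd; have := attainable_end; elim: (ends) => [_|e s IH H].
    by rewrite big_nil; exists (fun _ => 0) => //; rewrite big1.
  rewrite big_cons; have [u [v E]] :=
    Bezoutz e%:Z (\big[gcdn/0%N]_(x <- s) x)%:Z.
  rewrite -[_%:Z]/(gcdz e%:Z (\big[gcdn/0%N]_(x <- s) x)%:Z) -E.
  apply: attainable_comb; first by apply: H; rewrite inE eqxx.
  by apply: IH => x xs; apply: H; rewrite inE xs orbT.
move=> G /dvdzP[q ->]; have := attainable_comb q 0 G G.
by rewrite mul0r addr0.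
Qed.

(** The tail sums of [d] over [S] solve the difference equations, and counting
    each [d i] once for every index up to [i] gives their total; an attainable
    sum then cancels it. *)
Lemma prescribed_differences (d : 'I_n.-1 -> int) :
  (ends_gcd%:Z %| \sum_(i in S) (i.+1)%:Z * d i)%Z ->
  exists2 t : nat -> int, \sum_(i < n) t i = 0 &
    forall i, i \in S -> t (nat_of_ord i) - t (nat_of_ord i).+1 = d i.
Proof.
move/attainable_dvd => [u uS uE].
pose t a : int := \sum_(i in S | (a <= i)%N) d i.
exists (fun i => t i - u i) => [|i Si]; last first.
  have -> : t i = d i + t i.+1.
    rewrite /t (bigD1 i) ?Si ?leqnn//=; congr (_ + _); apply: eq_bigl => l.
    by rewrite -andbA; congr (_ && _);
      rewrite [RHS]ltn_neqAle andbC -val_eqE eq_sym.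
  by rewrite uS//; ring.
rewrite sumrB uE; apply/eqP; rewrite subr_eq0; apply/eqP.
rewrite (exchange_big_dep (mem S)) /= => [|a i _ /andP[]//].
apply: eq_bigr => i Si.
have i_n : (i.+1 <= n)%N by have := ltn_ord i; lia.
transitivity (\sum_(a < n | (a < i.+1)%N) d i); first by apply: eq_bigl => a;
  rewrite Si.
by rewrite -(big_ord_widen n (fun _ => d i) i_n) sumr_const card_ord
  -mulr_natr natz mulrC.
Qed.

Lemma intervalsE : intervals S = pairmap (fun a b => (b - a)%N) 0%N ends.
Proof. by []. Qed.

Lemma intervals_dvd : all (dvdn ends_gcd) (intervals S).
Proof.
rewrite intervalsE; move: (ends_gcd) ends_gcd_dvd => g.
suff H a s : (g %| a)%N -> all (dvdn g) s ->
    all (dvdn g) (pairmap (fun a b => (b - a)%N) a s) by exact: H.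
elim: s a => //= e s IH a da /andP[de ds].
by rewrite dvdn_sub//= IH.
Qed.

(** Numbering the indices from the start of their interval or from 0 changes the
    coefficient of [c i] by the starting point of the interval, which is a sum
    of parts and hence divisible by the gcd. *)
Lemma K_sum_mod (c : nat -> int) :
  (ends_gcd%:Z %| \sum_(i in S) (i.+1)%:Z * c i + K_sum S c)%Z.
Proof.
rewrite -(sum_notin_ends (fun i => i.+1%:Z * c i)).
have lastE : last 0%N ends = n by rewrite /ends last_rcons.
rewrite -{1}lastE -sum_between_ends ?ends_path// -intervalsE /K_sum.
rewrite -sumrB; apply: rpred_sum => l _; rewrite -sumrB big_seq_cond.
apply: rpred_sum => j; rewrite mem_index_iota => /andP[/andP[j1 _] _].
set s := (\sum_(_ <= _ < _) _)%N; rewrite add0n.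
have -> : (s + j - 1).+1 = (s + j)%N by lia.
rewrite PoszD mulrDl addrK; apply: dvdz_mulr; rewrite dvdzE /=.
apply: dvdn_sum => m _; have [ml|ml] := ltnP m (size (intervals S)).
  exact/(all_nthP 0%N intervals_dvd).
by rewrite nth_default.
Qed.

Lemma ends_gcd_dvd_parts_gcd : (ends_gcd %| parts_gcd S)%N.
Proof. by rewrite dvdn_biggcd intervals_dvd. Qed.

(** If the last index lies in [S], the number is [n * K]; otherwise both
    [n - 1] and [n] are ends of intervals and the gcd is 1. *)
Lemma last_sum_mod (K : int) :
  (ends_gcd%:Z %| \sum_(i in S) (i.+1)%:Z * (if is_last i then K else 0) + K)%Z.
Proof.
have n1 : (n - 2 < n.-1)%N by lia.
pose q : 'I_n.-1 := Ordinal n1.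
have lastE i : is_last i = (i == q) by rewrite /is_last -val_eqE /=;
  have := ltn_ord i; lia.
have n_dvd : (ends_gcd %| n)%N by exact: (allP ends_gcd_dvd _ n_in_ends).
have [Sq|Nq] := boolP (q \in S).
  rewrite (bigD1 q)//= lastE eqxx big1 => [|i /andP[_ /negbTE iq]];
    last by rewrite lastE iq mulr0.
  have -> : (n - 2).+1%:Z * K + 0 + K = n%:Z * K.
    have -> : n%:Z = (n - 2).+1%:Z + 1 by lia.
    by ring.
  by rewrite dvdz_mulr// dvdzE.
have : (ends_gcd %| q.+1)%N by apply: (allP ends_gcd_dvd); rewrite mem_ends_ord.
have nq : n = (q.+1 + 1)%N by rewrite /=; lia.
move: n_dvd; rewrite [X in (_ %| X)%N]nq => + q_dvd.
by rewrite dvdn_addr// => g1; rewrite dvdzE (dvdn_trans g1)// dvd1n.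
Qed.

Lemma translation_vector (c : nat -> int) (K : int) :
  (K = K_sum S c %[mod (parts_gcd S)%:Z])%Z ->
  exists2 t : nat -> int, \sum_(i < n) t i = 0 & forall i, i \in S ->
    t (nat_of_ord i) - t (nat_of_ord i).+1 = c i - (if is_last i then K else 0).
Proof.
move=> /eqP; rewrite eqz_mod_dvd => cong; apply: prescribed_differences.
have {cong} cong : (ends_gcd%:Z %| K - K_sum S c)%Z.
  by apply: dvdz_trans cong; rewrite dvdzE ends_gcd_dvd_parts_gcd.
under eq_bigr do rewrite mulrBr.
rewrite sumrB; set A := \sum_(i in S) _; set B := \sum_(i in S) _.
have -> : A - B = (A + K_sum S c) - (B + K) + (K - K_sum S c) by ring.
by rewrite rpredD// rpredB// ?K_sum_mod ?last_sum_mod.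
Qed.

End Ends.

(** * Translating flats *)

Section Translations.
Variables (R : realType) (n : nat) (r : R) (t : 'I_n -> int).
Hypothesis t_sum0 : \sum_i t i = 0.
Implicit Types (x z : 'rV[R]_n) (psi : affroot n).

Definition translate x : 'rV[R]_n := \row_i (x 0 i - (t i)%:~R).

Lemma in_apt_translate x : in_apt (translate x) = in_apt x.
Proof.
rewrite /in_apt; under eq_bigr do rewrite mxE.
by rewrite sumrB -(raddf_sum intr) t_sum0 subr0.
Qed.

Definition translate_root psi : affroot n :=
  (psi.1, psi.2 - t psi.1.1 + t psi.1.2).

Lemma affeval_translate psi x :
  affeval psi (translate x) = affeval (translate_root psi) x.
Proof. by rewrite /affeval !mxE /= intrD intrB; ring. Qed.

Lemma affeval_translateV psi x : exists2 psi', psi'.1 = psi.1 &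
  forall z, affeval psi z = affeval psi' (translate z).
Proof.
exists (psi.1, psi.2 + t psi.1.1 - t psi.1.2) => // z.
by rewrite affeval_translate /affeval /= !(intrD, intrB); ring.
Qed.

Lemma flat_translate x z : flat r (translate x) (translate z) <-> flat r x z.
Proof.
rewrite /flat /= in_apt_translate; split=> -[zA xz]; split=> // psi p.
  have [psi' e H] := affeval_translateV psi x; rewrite !H; apply: xz.
  by rewrite /is_affroot e.
by rewrite !affeval_translate; apply: xz.
Qed.

Lemma simple_flat_translate (S : {set 'I_n.-1}) (c c' : 'I_n.-1 -> int) z :
  (forall i, i \in S ->
     t (simple i 0).1.1 - t (simple i 0).1.2 = c i - c' i) ->
  simple_flat r S c (translate z) <-> simple_flat r S c' z.
Proof.
move=> tS; rewrite /simple_flat /= in_apt_translate.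
have E i : i \in S -> affeval (simple i (c i)) (translate z) =
  affeval (simple i (c' i)) z.
  move=> Si; rewrite affeval_translate /affeval /=; congr (_ + _%:~R).
  have := tS i Si => /=; lia.
split=> -[zA H]; split=> // i Si; have [_ e] := H i Si; split=> //.
  by rewrite -E.
- by rewrite in_apt_translate.
- by rewrite E.
Qed.

Lemma translate_surj z : exists y, z = translate y.
Proof.
exists (\row_i (z 0 i + (t i)%:~R)); apply/rowP => i.
by rewrite !mxE addrK.
Qed.

End Translations.

Theorem corollary4p5 (R : realType) (k : localField) (n p : nat)
    (hn : (2 <= n)%N) (hp : residue_char k p) (hpn : (3 * (n - 1) < p)%N)
    (r : R) (S : {set 'I_n.-1}) (c : nat -> int) (K : int)
    (hK : (K = K_sum S c %[mod (parts_gcd S)%:Z])%Z)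
    (F F' : set 'rV[R]_n)
    (hF : max_facet_in r (simple_flat r S c) F)
    (hF' : max_facet_in r (H_S r S K) F') :
  facet_associate k r F F'.
Proof.
have [/is_facetP[x xA Fx] _ _] := hF; have [/is_facetP[y yA Fy] _ _] := hF'.
subst F F'.
have flatx := flat_max_facet xA hF; have flaty := flat_max_facet yA hF'.
have [t t0 tS] := translation_vector hn hK.
pose tau (i : 'I_n) := t i.
have [g mg gE] := translation_exists R k (t0 : \sum_i tau i = 0).
have zA : in_apt (translate tau y) by rewrite in_apt_translate.
apply: (@facet_associate_monomial _ _ _ r g (Sub x xA) (Sub y yA) (Sub _ zA)) => //.
have tS' i : i \in S -> tau (simple i 0).1.1 - tau (simple i 0).1.2 =
    c i - (if is_last i then K else 0) by exact: tS.
rewrite /= flatx; apply/seteqP; split=> u; have [v ->] := translate_surj tau u.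
  move=> H; apply/(flat_translate _ t0); rewrite flaty.
  exact/(simple_flat_translate r t0 v tS').
move=> /(flat_translate _ t0); rewrite flaty => H.
exact/(simple_flat_translate r t0 v tS').
Qed.
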